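(* Let $\varphi$ be an endomorphism of a subshift $(X,\sigma)$. Let $s\in\mathbb Z$. (1) $\varphi$ is weakly $q$-R if and only if $Q_R(\varphi)\ge0$; furthermore, $\varphi\sigma^s$ is weakly $q$-R if and only if $s\ge -Q_R(\varphi)$; if $s>-Q_R(\varphi)$, then $\varphi\sigma^s$ is positively left $\sigma$-expansive. (2) $\varphi$ is weakly $q$-L if and only if $Q_L(\varphi)\ge0$; furthermore, $\varphi\sigma^s$ is weakly $q$-L if and only if $s\le Q_L(\varphi)$; if $s<Q_L(\varphi)$, then $\varphi\sigma^s$ is positively right $\sigma$-expansive.
   Context: **Subshifts.** An alphabet is a finite set with at least two elements. For an alphabet $A$, $A^{\mathbb Z}$ carries the product topology; the shift maps $(a_j)_j$ to $(a_{j+1})_j$. A subshift $(X,\sigma)$ over $A$ is a closed $X\subset A^{\mathbb Z}$ with $\sigma(X)=X$, $\sigma$ being the restricted shift; $d_X$ is a compatible metric; $L_k(X)$ is the set of words of length $k$ occurring in points of $X$. An endomorphism of $(X,\sigma)$ is a continuous map $\varphi:X\to X$ commuting with $\sigma$ (not assumed onto). **Type.** A local rule of neighborhood-size $N\ge 0$ on $X$ is a map $f:L_{N+1}(X)\to L_1(X)$ with $(f(a_j\dots a_{j+N}))_{j\in\mathbb Z}\in X$ for all $(a_j)\in X$. For $m,n\ge0$, $m+n=N$, $\varphi$ is of $(m,n)$-type given by $f$ if $\varphi((a_j)_j)=(f(a_{j-m}\dots a_{j+n}))_j$. Every endomorphism arises this way. **$q$-degrees.** A local rule $f$ of neighborhood-size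 $N$ is $k$ right-mergible ($k\ge0$) if for all $(a_j),(b_j)\in X$, $a_j=b_j$ for $j\le 0$ and $f(a_{j-N}\dots a_j)=f(b_{j-N}\dots b_j)$ for $1\le j\le k+1$ imply $a_1=b_1$; $k$ left-mergible if $a_j=b_j$ for $j\ge0$ and $f(a_{-j}\dots a_{-j+N})=f(b_{-j}\dots b_{-j+N})$ for $1\le j\le k+1$ imply $a_{-1}=b_{-1}$. It is strictly $k$ right-mergible if $k\ge 0$ is the least integer for which it is $k$ right-mergible, strictly $\infty$ right-mergible if there is none; similarly for left. If $X$ is infinite and $\varphi$ is of $(m,n)$-type given by $f$ which is strictly $k$ right-mergible and strictly $l$ left-mergible, then $Q_R(\varphi)=n-k$, $Q_L(\varphi)=m-l$; if $X$ is finite, $Q_R(\varphi)=Q_L(\varphi)=\infty$. These are independent of the choice of $f,m,n$. **Graphs and textile systems.** A graph is a finite directed graph $G$ (multiple arcs, loops allowed) with arc-set $A_G$, vertex-set $V_G$ and initial/terminal vertex maps $i_G,t_G$; $X_G\subset A_G^{\mathbb Z}$ is the set of bi-infinite paths. A graph-homomorphism $h=(h_A,h_V):\Gamma\to G$ is a pair of maps on arcs and vertices compatible with $i,t$; it induces $\phi_h:X_\Gamma\to X_G$, $(\alpha_j)\mapsto(h_A(\alpha_j))$. $h$ is weakly left-resolving (resp. weakly right-resolving) if every arc $\alpha$ of $\Gamma$ is uniquely determined by $t_\Gamma(\alpha)$ (resp. $i_\Gamma(\alpha)$) and $h_A(\alpha)$. A textile system $T=(p,q:\Gamma\to G)$ is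 a pair of graph-homomorphisms $p,q:\Gamma\to G$; it is weakly $q$-L (resp. weakly $q$-R) if $q$ is weakly left-resolving (resp. weakly right-resolving). An endomorphism $\varphi$ of $(X,\sigma)$ is weakly $q$-L (resp. weakly $q$-R) if there are a weakly $q$-L (resp. weakly $q$-R) textile system $T=(p,q:\Gamma\to G)$ and a closed shift-invariant $Z\subset X_\Gamma$ such that $\phi_p|_Z$ is injective, $\phi_p(Z)=X$, $\phi_q(Z)\subset X$ and $\varphi=\phi_q\circ(\phi_p|_Z)^{-1}$. **Expansiveness.** An endomorphism $\varphi$ is positively left (resp. right) $\sigma$-expansive if there is $\delta>0$ such that for $x,y\in X$, $d_X(\sigma^j\varphi^i(x),\sigma^j\varphi^i(y))\le\delta$ for all $i\ge0$ and $j\le0$ (resp. $j\ge0$) implies $x=y$. *)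

(* Defs.v *)
From HB Require Import structures.
From mathcomp Require Import all_boot all_order all_algebra.
From mathcomp Require Import all_classical all_reals all_analysis.

Set Implicit Arguments.
Unset Strict Implicit.
Unset Printing Implicit Defensive.

Import Order.TTheory GRing.Theory Num.Theory.
Local Open Scope classical_set_scope.
Local Open Scope ring_scope.

Notation fullshift A := (prod_topology (fun _ : int => discrete_topology A)).

(* [shiftz s] is sigma^s; sigma itself is [shiftz 1]. *)
Definition shiftz (A : choiceType) (s : int) (x : fullshift A) : fullshift A :=
  fun j => x (j + s).

(* The condition 2 <= #|A| on alphabets is kept separate, so that the same
   predicate serves for the spaces of bi-infinite paths of a graph. *)
Definition subshift (A : choiceType) (X : set (fullshift A)) : Prop :=
  closed X /\ shiftz 1 @` X = X.

(* Maps X -> X are represented by maps of the full shift; only their values on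
   X matter. *)
Definition endomorphism (A : choiceType) (X : set (fullshift A))
    (phi : fullshift A -> fullshift A) : Prop :=
  [/\ set_fun X X phi,
      {within X, continuous phi} &
      forall x, X x -> phi (shiftz 1 x) = shiftz 1 (phi x)].

(* Only the values of [d] on X matter. *)
Definition compatible_metric (A : choiceType) (X : set (fullshift A))
    (R : realType) (d : fullshift A -> fullshift A -> R) : Prop :=
  [/\ forall x y, X x -> X y -> 0 <= d x y,
      forall x y, X x -> X y -> (d x y = 0 <-> x = y),
      forall x y, X x -> X y -> d x y = d y x,
      forall x y z, X x -> X y -> X z -> d x z <= d x y + d y z &
      forall x, X x -> forall U : set (fullshift A),
        within X (nbhs x) U <->
        exists2 e, 0 < e & forall y, X y -> d x y < e -> U y].

Section Degrees.
Variables (A : finType) (X : set (fullshift A)).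

(* The word a_j ... a_(j+N). *)
Definition word (N : nat) (a : fullshift A) (j : int) : N.+1.-tuple A :=
  [tuple (a (j + i%:Z) : A) | i < N.+1].

(* A map L_(N+1)(X) -> L_1(X) is represented by a map on all words of length
   N+1; only its values on L_(N+1)(X) matter, and the condition forces these
   values into L_1(X). *)
Definition local_rule (N : nat) (f : N.+1.-tuple A -> A) : Prop :=
  forall a, X a -> X (fun j => f (word N a j)).

Definition of_type (phi : fullshift A -> fullshift A) (m n : nat)
    (f : (m + n).+1.-tuple A -> A) : Prop :=
  local_rule f /\
  forall a, X a -> phi a = (fun j => f (word (m + n) a (j - m%:Z))).

Definition right_mergible (N : nat) (f : N.+1.-tuple A -> A) (k : nat) : Prop :=
  forall a b, X a -> X b ->
    (forall j : int, j <= 0 -> a j = b j) ->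
    (forall j : int, 1 <= j <= k%:Z + 1 ->
       f (word N a (j - N%:Z)) = f (word N b (j - N%:Z))) ->
    a 1 = b 1.

Definition left_mergible (N : nat) (f : N.+1.-tuple A -> A) (k : nat) : Prop :=
  forall a b, X a -> X b ->
    (forall j : int, 0 <= j -> a j = b j) ->
    (forall j : int, 1 <= j <= k%:Z + 1 ->
       f (word N a (- j)) = f (word N b (- j))) ->
    a (- 1) = b (- 1).

Definition least_or_infty (P : nat -> Prop) (k : \bar int) : Prop :=
  (exists2 n : nat, k = (n%:Z)%:E & P n /\ forall i, P i -> (n <= i)%N)
  \/ (k = +oo%E /\ forall i, ~ P i).

Definition strictly_right_mergible (N : nat) (f : N.+1.-tuple A -> A) :=
  least_or_infty (right_mergible f).

Definition strictly_left_mergible (N : nat) (f : N.+1.-tuple A -> A) :=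
  least_or_infty (left_mergible f).

(* For X infinite, some presentation of phi is chosen; the value does not depend
   on the choice. The default +oo of [xget] is only reached if phi is not given
   by any local rule, hence never for an endomorphism. *)
Definition Q_R (phi : fullshift A -> fullshift A) : \bar int :=
  if `[< finite_set X >] then +oo%E
  else xget +oo%E [set q | exists m n (f : (m + n).+1.-tuple A -> A) k,
    [/\ of_type phi f, strictly_right_mergible f k & q = ((n%:Z)%:E - k)%E]].

Definition Q_L (phi : fullshift A -> fullshift A) : \bar int :=
  if `[< finite_set X >] then +oo%E
  else xget +oo%E [set q | exists m n (f : (m + n).+1.-tuple A -> A) l,
    [/\ of_type phi f, strictly_left_mergible f l & q = ((m%:Z)%:E - l)%E]].

End Degrees.

Record graph := Graph {
  g_arc : finType;
  g_vertex : finType;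
  g_init : g_arc -> g_vertex;
  g_term : g_arc -> g_vertex }.

Record graph_hom (Gamma G : graph) := GraphHom {
  hom_arc : g_arc Gamma -> g_arc G;
  hom_vertex : g_vertex Gamma -> g_vertex G;
  hom_init : forall a, g_init (hom_arc a) = hom_vertex (g_init a);
  hom_term : forall a, g_term (hom_arc a) = hom_vertex (g_term a) }.

Definition graph_paths (G : graph) : set (fullshift (g_arc G)) :=
  [set a | forall j : int, g_term (a j) = g_init (a (j + 1))].

Definition block_map (A B : choiceType) (h : A -> B) (a : fullshift A) :
  fullshift B := fun j => h (a j).

Definition phi_hom (Gamma G : graph) (h : graph_hom Gamma G) :
    fullshift (g_arc Gamma) -> fullshift (g_arc G) :=
  block_map (hom_arc h).

Definition weakly_left_resolving (Gamma G : graph) (h : graph_hom Gamma G) :=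
  forall a b, g_term a = g_term b -> hom_arc h a = hom_arc h b -> a = b.

Definition weakly_right_resolving (Gamma G : graph) (h : graph_hom Gamma G) :=
  forall a b, g_init a = g_init b -> hom_arc h a = hom_arc h b -> a = b.

Record textile := Textile {
  tx_Gamma : graph;
  tx_G : graph;
  tx_p : graph_hom tx_Gamma tx_G;
  tx_q : graph_hom tx_Gamma tx_G }.

(* phi = phi_q o (phi_p|_Z)^-1. The equality phi_p(Z) = X presupposes that the
   letters occurring in X are arcs of G; as the alphabet A and the arc-set of G
   are different types here, this identification is made by a map [iota] which
   is injective on L_1(X). *)
Definition presented_by (A : finType) (X : set (fullshift A))
    (phi : fullshift A -> fullshift A) (T : textile) : Prop :=
  exists (iota : A -> g_arc (tx_G T)) (Z : set (fullshift (g_arc (tx_Gamma T)))),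
  [/\ forall x y i j, X x -> X y -> iota (x i) = iota (y j) -> x i = y j,
      subshift Z /\ Z `<=` @graph_paths (tx_Gamma T),
      set_inj Z (phi_hom (tx_p T)) /\
        phi_hom (tx_p T) @` Z = block_map iota @` X,
      phi_hom (tx_q T) @` Z `<=` block_map iota @` X &
      forall z x, Z z -> X x -> phi_hom (tx_p T) z = block_map iota x ->
        block_map iota (phi x) = phi_hom (tx_q T) z].

Definition weakly_qL (A : finType) (X : set (fullshift A))
    (phi : fullshift A -> fullshift A) : Prop :=
  exists2 T : textile, weakly_left_resolving (tx_q T) & presented_by X phi T.

Definition weakly_qR (A : finType) (X : set (fullshift A))
    (phi : fullshift A -> fullshift A) : Prop :=
  exists2 T : textile, weakly_right_resolving (tx_q T) & presented_by X phi T.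

Definition positively_left_expansive (A : choiceType) (X : set (fullshift A))
    (R : realType) (d : fullshift A -> fullshift A -> R)
    (phi : fullshift A -> fullshift A) : Prop :=
  exists2 delta : R, 0 < delta & forall x y, X x -> X y ->
    (forall (i : nat) (j : int), j <= 0 ->
       d (shiftz j (iter i phi x)) (shiftz j (iter i phi y)) <= delta) ->
    x = y.

Definition positively_right_expansive (A : choiceType) (X : set (fullshift A))
    (R : realType) (d : fullshift A -> fullshift A -> R)
    (phi : fullshift A -> fullshift A) : Prop :=
  exists2 delta : R, 0 < delta & forall x y, X x -> X y ->
    (forall (i : nat) (j : int), 0 <= j ->
       d (shiftz j (iter i phi x)) (shiftz j (iter i phi y)) <= delta) ->
    x = y.

(* Main.v *)
Require Import Defs.
From mathcomp Require Import all_boot all_order all_algebra.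
From mathcomp Require Import all_classical all_reals all_analysis.
From mathcomp Require Import zify.

(** Everything is controlled by one property of an endomorphism [psi] and an
integer [Q], [right_determined]: a point known up to coordinate 0 whose image
is known up to coordinate [1 - Q] is known at coordinate 1. It gets weaker as
[Q] decreases, and replacing [psi] by [psi \o shiftz s] replaces [Q] by
[Q - s].

If [phi] is of (m,n)-type given by [f], then [f] is [k] right-mergible exactly
when [phi] is right determined for [n - k], because the coordinates of [phi a]
up to [- n] are computed from those of [a] up to 0. Hence
[right_determined X phi Q] holds iff [Q <= Q_R X phi]
([Q_R_right_determined]). The two boundary cases need an argument. If [X] is
finite, its points are periodic and every [Q] works. If [X] is infinite, no
[Q > n] works: the image would then add nothing to the past of the point, the
past alone would determine the future, and this forces [X] to be finite
([past_determined_finite]).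

Weakly q-R means right determined for 0. Given a textile system with [q]
weakly right-resolving, two points of [X] with the same past have lifts with
the same distant past, because the inverse of the injective block map [p] on
[Z] is itself a block map; the lifts then stay equal as long as their
[q]-labels, that is the images of the points, stay equal. Conversely, by
compactness the property for 0 only involves a bounded stretch of the past, of
length [L + 1] say; the graph whose arcs are the words of length [L + 2] of
pairs (point, image) is then a presentation of [psi] in which [q] is weakly
right-resolving.

If [psi] is right determined for 1, then knowing all the iterates
[iter i psi x] up to coordinate 0 gives all of them at coordinate 1, since the
image of one iterate is the next; repeating this gives [x]. As a small
distance forces equal letters at coordinate 0, uniformly on [X], this is
positive left expansiveness.

The statements about the left side follow by reversing the time axis. *)

Set Implicit Arguments.
Unset Strict Implicit.
Unset Printing Implicit Defensive.

Import Order.TTheory GRing.Theory Num.Theory.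
Local Open Scope classical_set_scope.
Local Open Scope ring_scope.

(** * Cylinders and subshifts *)

Section Cylinders.
Variable A : choiceType.
Implicit Types (x y : fullshift A) (X : set (fullshift A)).

Definition agree (L : nat) x y := forall j : int, (`|j| <= L)%N -> x j = y j.

Lemma agreeW L M x y : (L <= M)%N -> agree M x y -> agree L x y.
Proof. by move=> LM xy j /leq_trans/(_ LM); exact: xy. Qed.

Lemma nbhs_agree x (L : nat) : nbhs x [set y | agree L x y].
Proof.
have nbhs1 (j : int) : nbhs x [set y : fullshift A | x j = y j].
  have pc : {for x, continuous (proj j : fullshift A -> discrete_topology A)}.
    exact: proj_continuous.
  have x1 := discrete_set1 (x j : discrete_topology A).
  have {x1} := pc _ x1; apply: (@filterS _ (nbhs x)) => y /= xy.
  exact: esym.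
elim: L => [|L IH].
  by apply: filterS (nbhs1 0) => y /= xy j j0; rewrite (_ : j = 0) //; lia.
refine (filterS _ (filterI IH (filterI (nbhs1 L.+1%:Z) (nbhs1 (- L.+1%:Z))))).
move=> y [xy [xyp xyn]] j jL.
case: (leqP `|j| L) => [/xy //|Lj].
have [->//|->//] : j = L.+1%:Z \/ j = - L.+1%:Z by lia.
Qed.

Lemma nbhs_agreeP x (U : set (fullshift A)) :
  nbhs x U <-> exists L, [set y | agree L x y] `<=` U.
Proof.
split=> [xU|[L LU]]; last by apply: filterS LU (nbhs_agree x L).
pose F : set_system (fullshift A) :=
  [set V | exists L, [set y | agree L x y] `<=` V].
have FF : Filter F.
  split.
  - by exists 0%N.
  - move=> V W [L LV] [M MW]; exists (maxn L M) => y xy.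
    by split; [apply: LV|apply: MW]; apply: agreeW xy; rewrite ?leq_maxl ?leq_maxr.
  - by move=> V W VW [L LV]; exists L; exact: subset_trans LV VW.
suff : F --> x by exact.
apply/cvg_sup => i W [V [[Z oZ <-] Zx ZW]].
exists `|i|%N => y xy; apply: ZW => /=; have <- // := xy i.
Qed.

(** Closedness for the product topology, in the form in which it passes to
time reversals and to graphs of block maps. *)
Definition cyl_closed X :=
  forall x, (forall L, exists2 y, X y & agree L x y) -> X x.

Lemma closedP X : closed X <-> cyl_closed X.
Proof.
split=> [cX x xX|cX x xX].
  apply: cX => U /nbhs_agreeP[L LU]; have [y Xy xy] := xX L.
  by exists y; split=> //; exact: LU.
apply: cX => L; have [y [Xy xy]] := xX _ (nbhs_agree x L).
by exists y.
Qed.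

Lemma shiftz0 x : shiftz 0 x = x.
Proof. by apply/funext => j; rewrite /shiftz addr0. Qed.

Lemma shiftzD s t x : shiftz s (shiftz t x) = shiftz (s + t) x.
Proof. by apply/funext => j; rewrite /shiftz; congr (x _); lia. Qed.

Definition shift_invariant X := forall s x, X x -> X (shiftz s x).

Lemma subshiftP X : subshift X <-> cyl_closed X /\ shift_invariant X.
Proof.
rewrite /subshift closedP; split=> -[cX sX]; split=> //.
  have X1 x : X x -> X (shiftz 1 x) by move=> Xx; rewrite -sX; exists x.
  have Xn1 x : X x -> X (shiftz (-1) x).
    rewrite -{1}sX => -[y Xy <-].
    by rewrite shiftzD addNr shiftz0.
  have XN n x : X x -> X (shiftz n%:Z x) /\ X (shiftz (- n%:Z) x).
    move=> Xx; elim: n => [|n [IH1 IH2]]; first by rewrite oppr0 shiftz0.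
    move/X1: IH1; move/Xn1: IH2; rewrite !shiftzD.
    by rewrite (_ : -1 - _ = - n.+1%:Z :> int) 1?(_ : 1 + _ = n.+1%:Z :> int); [|lia..].
  move=> s x /(XN `|s|%N)[]; case: (lerP 0 s) => s0.
    by rewrite (_ : `|s|%N = s :> int) //; lia.
  by rewrite (_ : - `|s|%N%:Z = s :> int) //; lia.
apply/seteqP; split=> [_ [x Xx <-]|x Xx]; first exact: sX.
by exists (shiftz (-1) x); [exact: sX|rewrite shiftzD subrr shiftz0].
Qed.

End Cylinders.

(** * Compactness *)

(** Tychonoff's theorem: the sequence has a cluster point. *)
Lemma subsequential_limit (C : finType) (x : nat -> fullshift C) :
  exists y, forall L N, exists2 n, (N <= n)%N & agree L y (x n).
Proof.
have cptC : compact [set: fullshift C].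
  have := @tychonoff int (fun=> discrete_topology C) (fun=> setT).
  rewrite (_ : [set f | _] = setT); last by apply/seteqP; split.
  by apply=> i; apply: finite_compact; exact: finite_finset.
have [y [_ yx]] := cptC (x @ \oo) _ (filterT).
exists y => L N.
have xN : (x @ \oo) (x @` [set n | (N <= n)%N]).
  by exists N => // n /= Nn; exists n.
by have [_ [[n /= Nn <-] yz]] := yx _ _ xN (nbhs_agree y L); exists n.
Qed.

(** Compactness turns a conclusion drawn from infinitely many coordinates into
one drawn from a bounded window: otherwise the counterexamples for growing
windows accumulate at a counterexample for the unbounded statement. The
relation [E] depends on the position so that it may constrain a half-line
only, and letters may be pairs of which it compares one component. *)
Lemma uniform_determination (C : finType) (K : set (fullshift C))
    (E : int -> C -> C -> Prop) (E0 : C -> C -> Prop) (i : int) :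
  cyl_closed K ->
  (forall z w, K z -> K w -> (forall j, E j (z j) (w j)) -> E0 (z i) (w i)) ->
  exists L, forall z w, K z -> K w ->
    (forall j : int, (`|j| <= L)%N -> E j (z j) (w j)) -> E0 (z i) (w i).
Proof.
move=> cK KE; apply: contrapT => /forallNP H.
have {}H n : exists zw : fullshift C * fullshift C, [/\ K zw.1, K zw.2,
    (forall j : int, (`|j| <= n)%N -> E j (zw.1 j) (zw.2 j)) &
    ~ E0 (zw.1 i) (zw.2 i)].
  have /existsNP[z /existsNP[w]] := H n.
  by move=> /not_implyP[Kz] /not_implyP[Kw] /not_implyP[Ezw nE0]; exists (z, w).
have [zw zwP] := choice H.
have [y yP] := subsequential_limit
  (fun n => (fun j => ((zw n).1 j, (zw n).2 j)) : fullshift (C * C)%type).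
pose z : fullshift C := fun j => (y j).1.
pose w : fullshift C := fun j => (y j).2.
have zwy L N : exists n, [/\ (N <= n)%N, agree L z (zw n).1 & agree L w (zw n).2].
  have [n Nn yn] := yP L N.
  by exists n; split=> // j /yn; rewrite /z /w => ->.
have Kz : K z.
  by apply: cK => L; have [n [_ ? _]] := zwy L 0%N; exists (zw n).1 => //; case: (zwP n).
have Kw : K w.
  by apply: cK => L; have [n [_ _ ?]] := zwy L 0%N; exists (zw n).2 => //; case: (zwP n).
have [n [_ zn wn]] := zwy `|i|%N 0%N.
case: (zwP n) => _ _ _; rewrite -zn // -wn //; apply; apply: KE => // j.
have [m [jm zm wm]] := zwy `|j|%N `|j|%N.
by case: (zwP m) => _ _ Em _; rewrite zm // wm //; exact: Em.
Qed.

(** * Endomorphisms as sliding block codes *)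

Definition pair_seq (A B : finType) (x : fullshift A) (y : fullshift B) :
  fullshift (A * B)%type := fun j => (x j, y j).

Definition graph_of (A B : finType) (X : set (fullshift A))
    (F : fullshift A -> fullshift B) : set (fullshift (A * B)%type) :=
  [set z | exists2 x, X x & z = pair_seq x (F x)].

Definition cyl_continuous (A B : choiceType) (X : set (fullshift A))
    (F : fullshift A -> fullshift B) :=
  forall x, X x -> forall j, exists L, forall y, X y -> agree L x y -> F x j = F y j.

Lemma cyl_continuous_within (A B : choiceType) (X : set (fullshift A))
    (F : fullshift A -> fullshift B) :
  {within X, continuous F} -> cyl_continuous X F.
Proof.
move=> /subspace_continuousP cF x Xx j.
have /nbhs_agreeP[L LU] := cF x Xx _ (nbhs_agree (F x) `|j|%N).
by exists L => y Xy xy; apply: (LU y xy Xy j).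
Qed.

(** This makes [uniform_determination] applicable to conditions bearing on a
point and on its image at the same time. *)
Lemma graph_of_closed (A B : finType) (X : set (fullshift A))
    (F : fullshift A -> fullshift B) :
  cyl_closed X -> cyl_continuous X F -> cyl_closed (graph_of X F).
Proof.
move=> cX cF z zX; pose x : fullshift A := fun j => (z j).1.
have zx L : exists2 y, X y & agree L x y /\ agree L z (pair_seq y (F y)).
  have [_ [y Xy ->] zy] := zX L; exists y => //; split=> // j jL.
  by rewrite /x zy.
have Xx : X x by apply: cX => L; have [y Xy []] := zx L; exists y.
exists x => //; apply/funext => j; have [L xL] := cF x Xx j.
have [y Xy [xy zy]] := zx (maxn L `|j|).
rewrite zy ?leq_maxr // /pair_seq -xy ?leq_maxr // (xL y) //.
by apply: agreeW xy; rewrite leq_maxl.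
Qed.

Definition sliding_block (A : choiceType) (X : set (fullshift A))
    (phi : fullshift A -> fullshift A) :=
  [/\ forall x, X x -> X (phi x),
      exists M, forall x y, X x -> X y -> agree M x y -> phi x 0 = phi y 0 &
      forall s x, X x -> phi (shiftz s x) = shiftz s (phi x)].

Lemma sliding_block_at (A : choiceType) (X : set (fullshift A))
    (phi : fullshift A -> fullshift A) :
  shift_invariant X -> sliding_block X phi ->
  exists M : nat, forall x y j, X x -> X y ->
    (forall i : int, (`|i - j| <= M)%N -> x i = y i) -> phi x j = phi y j.
Proof.
move=> sX [_ [M phiM] phis]; exists M => x y j Xx Xy xy.
rewrite -[j]add0r -[LHS]/(shiftz j (phi x) 0) -[RHS]/(shiftz j (phi y) 0).
rewrite -!phis //; apply: phiM; [exact: sX..|] => i iM.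
by apply: xy; rewrite addrK.
Qed.

Lemma sliding_block_continuous (A : choiceType) (X : set (fullshift A))
    (phi : fullshift A -> fullshift A) :
  shift_invariant X -> sliding_block X phi -> cyl_continuous X phi.
Proof.
move=> sX /(sliding_block_at sX)[M phiM] x Xx j.
by exists (M + `|j|)%N => y Xy xy; apply: phiM => // i iM; apply: xy; lia.
Qed.

(** The theorem of Curtis, Hedlund and Lyndon: on the graph of [phi], equality of
all first components forces equality of the second components at 0, so by
compactness a window of first components suffices. *)
Lemma endomorphism_sliding_block (A : finType) (X : set (fullshift A))
    (phi : fullshift A -> fullshift A) :
  cyl_closed X -> shift_invariant X -> endomorphism X phi -> sliding_block X phi.
Proof.
move=> cX sX [phiX /cyl_continuous_within phic phi1]; split=> //.
- have := @uniform_determination _ _ (fun=> fun a b => a.1 = b.1)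
      (fun a b => a.2 = b.2) 0 (graph_of_closed cX phic).
  case=> [_ _ [x Xx ->] [y Xy ->] /= xy|M phiM].
    by congr (phi _ 0); apply/funext => j; exact: xy.
  exists M => x y Xx Xy xy.
  by apply: (phiM (pair_seq x (phi x)) (pair_seq y (phi y))) => //; [exists x|exists y].
- have phiN n x : X x -> phi (shiftz n%:Z x) = shiftz n%:Z (phi x).
    move=> Xx; elim: n => [|n IH]; first by rewrite !shiftz0.
    have -> : n.+1%:Z = 1 + n%:Z by lia.
    by rewrite -!shiftzD phi1 ?IH //; exact: sX.
  move=> s x Xx; case: (lerP 0 s) => s0.
    by rewrite (_ : s = `|s|%N%:Z) ?phiN //; lia.
  have {2}-> : x = shiftz `|s|%N%:Z (shiftz s x).
    by rewrite shiftzD (_ : _ + s = 0) ?shiftz0 //; lia.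
  rewrite phiN; last exact: sX.
  by rewrite shiftzD (_ : s + _ = 0) ?shiftz0 //; lia.
Qed.

Lemma sliding_block_shift (A : choiceType) (X : set (fullshift A))
    (phi : fullshift A -> fullshift A) s :
  shift_invariant X -> sliding_block X phi -> sliding_block X (phi \o shiftz s).
Proof.
move=> sX phiX; have [M phiM] := sliding_block_at sX phiX.
case: phiX => phiX _ phis; split=> [x Xx|| t x Xx] /=.
- by apply: phiX; exact: sX.
- exists (M + `|s|)%N => x y Xx Xy xy; rewrite !phis // /shiftz.
  by apply: phiM => // i iM; apply: xy; lia.
- by rewrite shiftzD addrC -shiftzD phis //; exact: sX.
Qed.

(** * Determination of the next letter *)

(** The supremum of these [Q] is the right q-degree of [psi]; the offset 1 makes
[Q = 0] the case in which the image is known exactly at the coordinate to be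
determined. *)
Definition right_determined (A : choiceType) (X : set (fullshift A))
    (psi : fullshift A -> fullshift A) (Q : int) :=
  forall a b, X a -> X b -> (forall j : int, j <= 0 -> a j = b j) ->
    (forall j : int, j <= 1 - Q -> psi a j = psi b j) -> a 1 = b 1.

Section RightDetermined.
Variables (A : choiceType) (X : set (fullshift A)) (psi : fullshift A -> fullshift A).
Hypotheses (sX : shift_invariant X)
  (psis : forall s x, X x -> psi (shiftz s x) = shiftz s (psi x)).

Lemma right_determined_at Q i a b : right_determined X psi Q -> X a -> X b ->
  (forall j : int, j <= i -> a j = b j) ->
  (forall j : int, j <= i + 1 - Q -> psi a j = psi b j) -> a (i + 1) = b (i + 1).
Proof.
move=> D Xa Xb ab pab; have := D (shiftz i a) (shiftz i b).
rewrite /shiftz [1 + i]addrC; apply; [exact: sX..| |] => j jQ.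
  by apply: ab; lia.
by rewrite -!/(shiftz i _) !psis // /shiftz pab //; lia.
Qed.

Lemma right_determinedW Q Q' : Q' <= Q ->
  right_determined X psi Q -> right_determined X psi Q'.
Proof.
by move=> QQ D a b Xa Xb ab pab; apply: D => // j jQ; apply: pab; lia.
Qed.

Lemma right_determined_shift Q s :
  right_determined X (psi \o shiftz s) Q <-> right_determined X psi (Q - s).
Proof.
split=> D a b Xa Xb ab pab; apply: D => // j jQ.
  by rewrite /= !psis // /shiftz pab //; lia.
have := pab (j - s); rewrite /= !psis // /shiftz subrK; apply; lia.
Qed.

(** The image of [iter i psi a] is the next iterate, hence known as far as
[iter i psi a] itself: all the iterates advance together by one coordinate. *)
Lemma right_determined_orbit a b : right_determined X psi 1 ->
  (forall x, X x -> X (psi x)) -> X a -> X b ->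
  (forall i (j : int), j <= 0 -> iter i psi a j = iter i psi b j) -> a = b.
Proof.
move=> D psiX Xa Xb ab.
have Xi i x : X x -> X (iter i psi x) by move=> Xx; elim: i => //= i; exact: psiX.
have {}ab (n : nat) i (j : int) : j <= n%:Z -> iter i psi a j = iter i psi b j.
  elim: n i j => [|n IH] i j jn; first exact: ab.
  have [jn'|->] : j <= n%:Z \/ j = n%:Z + 1 by lia.
    exact: IH.
  apply: (right_determined_at D); [exact: Xi..|exact: IH|].
  by move=> k; rewrite addrK -!iterS; exact: IH.
by apply/funext => j; apply: (ab `|j|%N 0%N); lia.
Qed.

End RightDetermined.

(** * Weakly q-R endomorphisms *)

(** The lifts of [a] and [b] to [Z] agree far enough to the left, and from there
on the arcs of both are forced by their common initial vertex and their common
[q]-label, up to coordinate 1. *)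
Lemma weakly_qR_right_determined (A : finType) (X : set (fullshift A))
    (psi : fullshift A -> fullshift A) :
  (forall x, X x -> X (psi x)) -> weakly_qR X psi -> right_determined X psi 0.
Proof.
move=> psiX [[Gam G p q] /= qR [iota [Z [/= inj_iota [/subshiftP[cZ sZ] Zpath]]]]].
move=> [inj_p pZ] qZ psiE a b Xa Xb ab pab.
have lift_pt x : X x -> exists2 z, Z z & phi_hom p z = block_map iota x.
  move=> Xx; have : (block_map iota @` X) (block_map iota x) by exists x.
  by rewrite -pZ => -[z Zz zx]; exists z.
have [z Zz za] := lift_pt a Xa; have [w Zw wb] := lift_pt b Xb.
have pz j : hom_arc p (z j) = iota (a j) by move/(congr1 (@^~ j)): za.
have pw j : hom_arc p (w j) = iota (b j) by move/(congr1 (@^~ j)): wb.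
have qz j : hom_arc q (z j) = iota (psi a j).
  by move/(congr1 (@^~ j)): (psiE _ _ Zz Xa za).
have qw j : hom_arc q (w j) = iota (psi b j).
  by move/(congr1 (@^~ j)): (psiE _ _ Zw Xb wb).
(* The inverse of [phi_hom p] on [Z] is a block map with window [L]. *)
have [||L ZL] := @uniform_determination _ Z
    (fun=> fun e f => hom_arc p e = hom_arc p f) (fun e f => e = f) 0 => //.
  move=> u v Zu Zv uv; congr (_ 0); apply: inj_p; rewrite ?inE //.
  by apply/funext => j; exact: uv.
have zw0 j : j <= - L%:Z -> z j = w j.
  move=> jL; have := ZL (shiftz j z) (shiftz j w) (sZ _ _ Zz) (sZ _ _ Zw).
  rewrite /shiftz add0r; apply => i iL.
  by rewrite pz pw ab //; lia.
have zw (n : nat) : n%:Z - L%:Z <= 1 -> z (n%:Z - L%:Z) = w (n%:Z - L%:Z).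
  elim: n => [|n IH] n1; first by apply: zw0; lia.
  have e : n.+1%:Z - L%:Z = n%:Z - L%:Z + 1 by lia.
  apply: qR; last by rewrite qz qw pab //; lia.
  by rewrite e -(Zpath _ Zz) -(Zpath _ Zw) IH //; lia.
have := zw L.+1; rewrite (_ : L.+1%:Z - L%:Z = 1); last by lia.
by move=> /(_ isT) zw1; apply: (inj_iota a b) => //; rewrite -pz -pw zw1.
Qed.

(** The presentation used for the converse: arcs are words of length [L + 2] of
the graph of [psi], vertices their prefixes and suffixes of length [L + 1], and
[p] and [q] read the two components of the last letter. The codomain is the
graph with a single vertex and one loop for each letter. *)
Section HigherBlockTextile.
Variables (A : finType) (X : set (fullshift A)) (psi : fullshift A -> fullshift A).
Variable L : nat.

Definition history (x : fullshift A) (j : int) : L.+2.-tuple (A * A)%type :=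
  word L.+1 (pair_seq x (psi x)) (j - 1 - L%:Z).

(** By shift invariance every word of the graph of [psi] occurs as the history at
coordinate 1, the coordinate at which [right_determined] concludes. *)
Definition history_arc :=
  {w : L.+2.-tuple (A * A)%type | `[< exists2 x, X x & w = history x 1 >]}.

Definition history_graph := @Graph history_arc (L.+1.-tuple (A * A)%type)
  (fun w => [tuple tnth (val w) (widen_ord (leqnSn _) i) | i < L.+1])
  (fun w => [tuple tnth (val w) (lift ord0 i) | i < L.+1]).

Definition letter_graph := @Graph A unit (fun=> tt) (fun=> tt).

Definition history_p : graph_hom history_graph letter_graph :=
  @GraphHom history_graph letter_graph (fun w : history_arc => (tnth (val w) ord_max).1)
    (fun=> tt) (fun=> erefl) (fun=> erefl).

Definition history_q : graph_hom history_graph letter_graph :=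
  @GraphHom history_graph letter_graph (fun w : history_arc => (tnth (val w) ord_max).2)
    (fun=> tt) (fun=> erefl) (fun=> erefl).

Lemma tnth_history x j (i : 'I_L.+2) : let k := j - 1 - L%:Z + i%:Z in
  tnth (history x j) i = (x k, psi x k).
Proof. by rewrite tnth_mktuple. Qed.

Lemma tnth_history_max x j : tnth (history x j) ord_max = (x j, psi x j).
Proof. by rewrite tnth_history /= (_ : _ + _ = j) //; lia. Qed.

Hypotheses (cX : cyl_closed X) (sX : shift_invariant X) (psiX : sliding_block X psi).

Lemma history_shift s x j : X x -> history (shiftz s x) j = history x (j + s).
Proof.
case: psiX => _ _ psis Xx; apply: eq_from_tnth => i.
rewrite !tnth_history /= psis // /shiftz.
by rewrite (_ : j - 1 - L%:Z + i + s = j + s - 1 - L%:Z + i) //; lia.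
Qed.

Lemma history_occurs x j : X x -> `[< exists2 y, X y & history x j = history y 1 >].
Proof.
move=> Xx; apply/asboolP; exists (shiftz (j - 1) x); first exact: sX.
by rewrite history_shift // addrC subrK.
Qed.

Definition history_path (x : fullshift A) (Xx : X x) : fullshift history_arc :=
  fun j => exist _ (history x j) (history_occurs j Xx).

Definition history_paths : set (fullshift history_arc) :=
  [set z | exists2 x, X x & forall j, val (z j) = history x j].

Lemma history_pathsP x : X x ->
  exists2 z, history_paths z & forall j, val (z j) = history x j.
Proof. by move=> Xx; exists (history_path Xx) => //; exists x. Qed.

(** The [p]-labels of a limit of history paths spell a point of [X], whose
histories are the given arcs because [psi] has a finite window. *)
Lemma history_paths_subshift : subshift history_paths.
Proof.
apply/subshiftP; split; last first.
  move=> s z [x Xx zx]; exists (shiftz s x); first exact: sX.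
  by move=> j; rewrite history_shift // -zx.
have [M psiM] := sliding_block_at sX psiX.
move=> z zZ; pose x : fullshift A := fun j => (tnth (val (z j)) ord_max).1.
have zx N : exists2 y, X y &
    agree N x y /\ forall j : int, (`|j| <= N)%N -> val (z j) = history y j.
  have [w [y Xy wy] zw] := zZ N; exists y => //.
  by split=> j jN; rewrite ?/x zw // wy // tnth_history_max.
have Xx : X x by apply: cX => N; have [y Xy []] := zx N; exists y.
exists x => // j; have [y Xy [xy zy]] := zx (`|j| + L + M + 1)%N.
rewrite zy; last by lia.
apply: eq_from_tnth => i; rewrite !tnth_history /=; have := ltn_ord i => iL.
rewrite xy; last by lia.
by congr pair; apply/esym/psiM => // k kM; apply: xy; lia.
Qed.

Lemma history_paths_presentation :
  presented_by X psi (Textile history_p history_q).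
Proof.
have inX : block_map (idfun : A -> A) @` X = X.
  by apply/seteqP; split=> [_ [x Xx <-]//|x Xx]; exists x.
have pE z x : (forall j, val (z j) = history x j) -> phi_hom history_p z = x.
  by move=> zx; apply/funext => j; rewrite /phi_hom /block_map /= zx tnth_history_max.
have qE z x : (forall j, val (z j) = history x j) -> phi_hom history_q z = psi x.
  by move=> zx; apply/funext => j; rewrite /phi_hom /block_map /= zx tnth_history_max.
exists (idfun : A -> A), history_paths; rewrite /= inX; split=> //.
- split; first exact: history_paths_subshift.
  move=> z [x Xx zx] j; apply: eq_from_tnth => i.
  rewrite !tnth_mktuple !zx !tnth_history /=.
  by rewrite (_ : j + 1 - 1 - L%:Z + i = j - 1 - L%:Z + bump 0 i) // /bump; lia.
- split; last first.
    apply/seteqP; split=> [_ [z [x Xx zx] <-]|x Xx]; first by rewrite (pE _ _ zx).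
    by have [z Zz zx] := history_pathsP Xx; exists z => //; exact: pE.
  move=> z w /set_mem[x Xx zx] /set_mem[y Xy wy].
  rewrite (pE _ _ zx) (pE _ _ wy) => xy; apply/funext => j; apply: val_inj.
  by rewrite zx wy xy.
- by case: psiX => psiX' _ _ _ [z [x Xx zx] <-]; rewrite (qE _ _ zx); exact: psiX'.
- move=> z x [y Xy zy] Xx; rewrite (pE _ _ zy) (qE _ _ zy) => yx.
  by rewrite yx.
Qed.

End HigherBlockTextile.

(** The bound [L] given by compactness is the memory for which an arc of the
history graph is determined by its initial vertex and its [q]-label. *)
Lemma right_determined_weakly_qR (A : finType) (X : set (fullshift A))
    (psi : fullshift A -> fullshift A) :
  cyl_closed X -> shift_invariant X -> sliding_block X psi ->
  right_determined X psi 0 -> weakly_qR X psi.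
Proof.
move=> cX sX psiX D.
have psic := sliding_block_continuous sX psiX.
have [_ _ [x Xx ->] [y Xy ->] xy|L HL] := @uniform_determination _ (graph_of X psi)
    (fun j c e => (j <= 0 -> c.1 = e.1) /\ (j <= 1 -> c.2 = e.2))
    (fun c e => c.1 = e.1) 1 (graph_of_closed cX psic).
  by apply: D => // j j0; have [] := xy j; [move=> /(_ j0)|move=> _ /(_ j0)].
exists (Textile (history_p X psi L) (history_q X psi L)); last first.
  exact: history_paths_presentation.
move=> /= [u /= pu] [v /= pv] uv uv1; apply: val_inj => /=.
move: pu pv uv uv1 => /asboolP[x Xx ->] /asboolP[y Xy ->].
rewrite /= !tnth_history_max /= => uv uv1.
have xy (j : int) : - L%:Z <= j <= 0 -> (x j, psi x j) = (y j, psi y j).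
  move=> jL; have iL : (`|(j + L%:Z)%R| < L.+1)%N by lia.
  have := congr1 (fun t => tnth t (Ordinal iL)) uv.
  rewrite !tnth_mktuple /pair_seq /=.
  by have -> : 1 - 1 - L%:Z + `|(j + L%:Z)%R|%N%:Z = j by lia.
have xy1 : x 1 = y 1.
  apply: (HL (pair_seq x (psi x)) (pair_seq y (psi y))); [by exists x|by exists y|].
  move=> j jL /=; split=> j1.
    by have /xy[] : - L%:Z <= j <= 0 by lia.
  have [j0|->//] : j <= 0 \/ j = 1 by lia.
  by have /xy[] : - L%:Z <= j <= 0 by lia.
apply: eq_from_tnth => i; rewrite !tnth_history /=; have := ltn_ord i => iL.
have [j0|->] : 1 - 1 - L%:Z + i%:Z <= 0 \/ 1 - 1 - L%:Z + i%:Z = 1 by lia.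
  by apply: xy; lia.
by rewrite xy1 uv1.
Qed.

Lemma weakly_qRP (A : finType) (X : set (fullshift A))
    (psi : fullshift A -> fullshift A) :
  cyl_closed X -> shift_invariant X -> sliding_block X psi ->
  weakly_qR X psi <-> right_determined X psi 0.
Proof.
move=> cX sX psiX; split; last exact: right_determined_weakly_qR.
by case: psiX => psiX _ _; exact: weakly_qR_right_determined.
Qed.

(** * Right q-degrees *)

(** Both points lie on finite orbits, so they have a common period, and
coordinate 1 is read in the past. *)
Lemma finite_right_determined (A : choiceType) (X : set (fullshift A))
    (psi : fullshift A -> fullshift A) Q :
  shift_invariant X -> finite_set X -> right_determined X psi Q.
Proof.
move=> sX fX a b Xa Xb ab _.
pose g (n : nat) := (shiftz (- n%:Z) a, shiftz (- n%:Z) b).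
have gX n : (X `*` X) (g n) by split; exact: sX.
have [g_inj|] := pselect (injective g).
  case: infinite_nat; rewrite (_ : setT = g @^-1` (X `*` X)).
    by apply: finite_preimage; [move=> ? ? _ _; exact: g_inj|exact: finite_setX].
  by apply/seteqP; split=> // n _; exact: gX.
move=> /existsNP[n /existsNP[m /not_implyP[gnm nm]]].
wlog lt_nm : n m gnm nm / (n < m)%N.
  move=> H; have [nm'|mn] : (n < m)%N \/ (m < n)%N by lia.
    exact: (H n m).
  by apply: (H m n) => // /esym.
move: gnm => [ga gb].
have per (x : fullshift A) : shiftz (- n%:Z) x = shiftz (- m%:Z) x ->
    x 1 = x (1 + n%:Z - m%:Z).
  by move=> /(congr1 (@^~ (1 + n%:Z))); rewrite /shiftz addrK.
rewrite (per a ga) (per b gb); apply: ab; lia.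
Qed.

(** By compactness words of a fixed length [L + 1] determine the next letter, so
the shift induces a map [G] on the finite set [S] of these words. Every word
can be extended to the left, hence [G] is onto, hence one-to-one. So a single
word determines the past as well, and the points of [X] are as few as the
words in [S]. *)
Lemma past_determined_finite (A : finType) (X : set (fullshift A)) :
  cyl_closed X -> shift_invariant X ->
  (forall a b, X a -> X b -> (forall j : int, j <= 0 -> a j = b j) -> a 1 = b 1) ->
  finite_set X.
Proof.
move=> cX sX past.
have [->|/set0P[x0 _]] := eqVneq X set0; first exact: finite_set0.
have [L XL] := @uniform_determination _ X (fun j c e => j <= 0 -> c = e)
  (fun c e => c = e) 1 cX past.
pose W (x : fullshift A) : L.+1.-tuple A := word L x (- L%:Z).
have WE x y : W x = W y <-> forall j : int, - L%:Z <= j <= 0 -> x j = y j.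
  split=> [xy j jL|xy].
    have iL : (`|(j + L%:Z)%R| < L.+1)%N by lia.
    have := congr1 (fun t => tnth t (Ordinal iL)) xy.
    rewrite !tnth_mktuple /=.
    by have -> : - L%:Z + `|(j + L%:Z)%R|%N%:Z = j by lia.
  apply: eq_from_tnth => i; have := ltn_ord i => iL.
  by rewrite !tnth_mktuple; apply: xy; lia.
pose rep w := xget x0 [set x | X x /\ W x = w].
have repP x : X x -> X (rep (W x)) /\ W (rep (W x)) = W x.
  by move=> Xx; apply: (@xgetPex _ x0 [set y | X y /\ W y = W x]); exists x.
pose G w := W (shiftz 1 (rep w)).
have GW x : X x -> G (W x) = W (shiftz 1 x).
  move=> Xx; have [Xr /WE rx] := repP _ Xx; apply/WE => j jL; rewrite /shiftz.
  have [j0|->] : j + 1 <= 0 \/ j = 0 by lia.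
    by apply: rx; lia.
  rewrite add0r; apply: XL => // i iL i0; apply: rx; lia.
pose S := finset (fun w => `[< exists2 x, X x & w = W x >]).
have SW x : X x -> W x \in S by move=> Xx; rewrite inE; apply/asboolP; exists x.
have G_inj : {in S &, injective G}.
  apply/imset_injP; rewrite eqn_leq leq_imset_card subset_leq_card //.
  apply/fintype.subsetP => w; rewrite inE => /asboolP[x Xx ->].
  apply/imsetP; exists (W (shiftz (-1) x)); first by apply/SW/sX.
  by rewrite GW ?shiftzD ?subrr ?shiftz0 //; exact: sX.
have W_inj x y : X x -> X y -> W x = W y -> x = y.
  move=> Xx Xy xy.
  have {xy} xyn (n : nat) : W (shiftz (- n%:Z) x) = W (shiftz (- n%:Z) y).
    elim: n => [|n IH]; first by rewrite oppr0 !shiftz0.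
    apply: G_inj; rewrite ?SW ?GW ?shiftzD //; try exact: sX.
    by rewrite (_ : 1 - n.+1%:Z = - n%:Z) //; lia.
  have xy0 (j : int) : j <= 0 -> x j = y j.
    move=> j0; have /WE/(_ 0) := xyn `|j|%N.
    by rewrite /shiftz (_ : 0 - `|j|%N%:Z = j); [apply; lia|lia].
  have xyn' (n : nat) : forall j : int, j <= n%:Z -> x j = y j.
    elim: n => [//|n IH] j jn.
    have [jn'|->] : j <= n%:Z \/ j = 1 + n%:Z by lia.
      exact: IH.
    apply: (past (shiftz n%:Z x) (shiftz n%:Z y)); [exact: sX..|].
    by move=> k k0; apply: IH; lia.
  by apply/funext => j; apply: (xyn' `|j|%N); lia.
have fW : finite_set (rep @` [set: L.+1.-tuple A]).
  by apply: finite_image; exact: finite_finset.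
apply: sub_finite_set fW => x Xx; exists (W x) => //.
by have [Xr Wr] := repP x Xx; exact: W_inj.
Qed.

(** For [Q > n] the known part of the image depends on the known part of the
point only. *)
Lemma infinite_right_determined_le (A : finType) (X : set (fullshift A))
    (phi : fullshift A -> fullshift A) (m n : nat) (f : (m + n).+1.-tuple A -> A) Q :
  cyl_closed X -> shift_invariant X -> ~ finite_set X -> of_type X phi f ->
  right_determined X phi Q -> Q <= n%:Z.
Proof.
move=> cX sX nfX [_ phiE] D; rewrite leNgt; apply/negP => nQ; apply: nfX.
apply: past_determined_finite => // a b Xa Xb ab; apply: D => // j jQ.
rewrite !phiE //; congr f; apply: eq_from_tnth => i; rewrite !tnth_mktuple.
by have := ltn_ord i => imn; apply: ab; lia.
Qed.

(** Mergibility only asks for equal images from coordinate [1 - n] on; the images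
of two points with the same past agree before that. *)
Lemma right_mergibleP (A : finType) (X : set (fullshift A))
    (phi : fullshift A -> fullshift A) (m n : nat) (f : (m + n).+1.-tuple A -> A) k :
  of_type X phi f ->
  right_mergible X f k <-> right_determined X phi (n%:Z - k%:Z).
Proof.
move=> [_ phiE].
have fE a (j : int) : X a -> f (word (m + n) a (j - (m + n)%N%:Z)) = phi a (j - n%:Z).
  by move=> Xa; rewrite phiE //; congr (f (word _ _ _)); lia.
split=> H a b Xa Xb ab pab; apply: H => // j jk.
  by rewrite !fE // pab //; lia.
have [j0|j1] := lerP (j + n%:Z) 0.
  rewrite !phiE //; congr f; apply: eq_from_tnth => i; rewrite !tnth_mktuple.
  by have := ltn_ord i => imn; apply: ab; lia.
by have := pab (j + n%:Z); rewrite !fE // addrK; apply; lia.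
Qed.

Lemma least_or_infty_exists (P : nat -> Prop) : exists k, least_or_infty P k.
Proof.
have [[n Pn]|nP] := pselect (exists n, P n); last first.
  by exists +oo%E; right; split=> // i Pi; apply: nP; exists i.
have exP : exists n, `[< P n >] by exists n; exact/asboolP.
exists ((ex_minn exP)%:Z)%:E; left; exists (ex_minn exP) => //.
case: ex_minnP => k /asboolP Pk kmin; split=> // i Pi.
by apply: kmin; exact/asboolP.
Qed.

(** An integer [Q <= n] is [n - i] for a natural number [i], so [P] describes
[D] up to [n]; the bound on [D] excludes the [Q] above [n], which would
correspond to negative mergibility indices. *)
Lemma least_or_infty_degree (D : int -> Prop) (P : nat -> Prop) (n : nat) k :
  (forall Q Q', Q' <= Q -> D Q -> D Q') -> (forall Q, D Q -> Q <= n%:Z) ->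
  (forall i, P i <-> D (n%:Z - i%:Z)) -> least_or_infty P k ->
  forall Q, D Q <-> (Q%:E <= (n%:Z)%:E - k)%E.
Proof.
move=> DW Dn PD Pk Q.
have DP : D Q -> exists2 i, P i & Q = n%:Z - i%:Z.
  move=> DQ; have Qn := Dn _ DQ; exists `|(n%:Z - Q)%R|%N; last by lia.
  by apply/PD; apply: DW DQ; lia.
case: Pk => [[i -> [Pi imin]]|[-> nP]].
  rewrite -EFinB lee_fin; split=> [/DP[i' /imin ii' ->]|Qi]; first by lia.
  by move/PD: Pi; exact: DW.
split=> [/DP[i /nP//]|]; by rewrite /= leeNy_eq.
Qed.

(** A window [- M, M] gives a presentation of (M,M)-type. *)
Lemma of_type_exists (A : finType) (X : set (fullshift A))
    (phi : fullshift A -> fullshift A) :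
  (0 < #|A|)%N -> shift_invariant X -> sliding_block X phi ->
  exists m n (f : (m + n).+1.-tuple A -> A), of_type X phi f.
Proof.
move=> /card_gt0P[a0 _] sX [phiX [M phiM] phis].
pose W (x : fullshift A) := word (M + M) x (- M%:Z).
pose f w := phi (xget (fun=> a0) [set x | X x /\ W x = w]) 0.
have fE a j : X a -> f (word (M + M) a (j - M%:Z)) = phi a j.
  move=> Xa; have -> : word (M + M) a (j - M%:Z) = W (shiftz j a).
    apply: eq_from_tnth => i; rewrite !tnth_mktuple /shiftz.
    by congr (a _); lia.
  have [|Xx Wx] := @xgetPex _ (fun=> a0) [set x | X x /\ W x = W (shiftz j a)].
    by exists (shiftz j a); split=> //; exact: sX.
  rewrite -[j in RHS]add0r -[RHS]/(shiftz j (phi a) 0) -phis //.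
  apply: phiM => //; first exact: sX.
  move=> i iM; have iL : (`|(i + M%:Z)%R| < (M + M).+1)%N by lia.
  have := congr1 (fun t => tnth t (Ordinal iL)) Wx.
  rewrite !tnth_mktuple /=.
  by have -> : - M%:Z + `|(i + M%:Z)%R|%N%:Z = i by lia.
exists M, M, f; split=> a Xa; last by apply/funext => j; rewrite fE.
rewrite (_ : (fun _ => _) = phi (shiftz M%:Z a)); first by apply/phiX/sX.
by apply/funext => j; rewrite phis // /shiftz -fE // addrK.
Qed.

Lemma Q_R_right_determined (A : finType) (X : set (fullshift A))
    (phi : fullshift A -> fullshift A) Q :
  (0 < #|A|)%N -> cyl_closed X -> shift_invariant X -> sliding_block X phi ->
  right_determined X phi Q <-> (Q%:E <= Q_R X phi)%E.
Proof.
move=> A0 cX sX phiX; rewrite /Q_R; case: asboolP => [fX|nfX].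
  by rewrite leey; split=> // _; exact: finite_right_determined.
set S := [set q | _]; have : S !=set0.
  have [m [n [f phif]]] := of_type_exists A0 sX phiX.
  have [k fk] := least_or_infty_exists (right_mergible X f).
  by exists ((n%:Z)%:E - k)%E, m, n, f, k; split.
move=> /(xgetPex +oo%E)[m [n [f [k [phif fk ->]]]]].
apply: least_or_infty_degree fk Q.
- by move=> ? ?; exact: right_determinedW.
- by move=> Q0; exact: (infinite_right_determined_le cX sX nfX phif).
- by move=> i; exact: (right_mergibleP i phif).
Qed.

(** * Time reversal *)

Section Mirror.
Variable A : choiceType.
Implicit Types (X : set (fullshift A)) (phi : fullshift A -> fullshift A).

Definition mirror (x : fullshift A) : fullshift A := fun j => x (- j).

Definition mirror_set X : set (fullshift A) := [set x | X (mirror x)].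

Definition mirror_map phi := mirror \o phi \o mirror.

Lemma mirrorK : involutive mirror.
Proof. by move=> x; apply/funext => j; rewrite /mirror opprK. Qed.

Lemma mirror_shiftz s x : mirror (shiftz s x) = shiftz (- s) (mirror x).
Proof. by apply/funext => j; rewrite /mirror /shiftz; congr (x _); lia. Qed.

Lemma mirror_mapK phi : mirror_map (mirror_map phi) = phi.
Proof. by apply/funext => x; rewrite /mirror_map /= !mirrorK. Qed.

Lemma mirror_agree L x y : agree L x y -> agree L (mirror x) (mirror y).
Proof. by move=> xy j jL; apply: xy; lia. Qed.

Lemma mirror_cyl_closed X : cyl_closed X -> cyl_closed (mirror_set X).
Proof.
move=> cX x xX; apply: cX => L; have [y Xy xy] := xX L.
by exists (mirror y) => //; exact: mirror_agree.
Qed.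

Lemma mirror_shift_invariant X : shift_invariant X -> shift_invariant (mirror_set X).
Proof. by move=> sX s x Xx; rewrite /mirror_set /= mirror_shiftz; exact: sX. Qed.

Lemma mirror_sliding_block X phi : sliding_block X phi ->
  sliding_block (mirror_set X) (mirror_map phi).
Proof.
move=> [phiX [M phiM] phis]; split=> [x Xx||s x Xx].
- by rewrite /mirror_set /mirror_map /= mirrorK; exact: phiX.
- exists M => x y Xx Xy xy; rewrite /mirror_map /= /mirror oppr0.
  by apply: phiM => //; exact: mirror_agree.
- by rewrite /mirror_map /= mirror_shiftz phis // mirror_shiftz opprK.
Qed.

Lemma mirror_preimageK X : mirror_set (mirror_set X) = X.
Proof. by apply/seteqP; split=> x; rewrite /mirror_set /= mirrorK. Qed.

Lemma mirror_finite X : finite_set (mirror_set X) <-> finite_set X.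
Proof.
have fX Y : finite_set Y -> finite_set (mirror_set Y).
  by apply: finite_preimage => x y _ _; exact: (inv_inj mirrorK).
by split; [rewrite -{2}[X]mirror_preimageK|]; exact: fX.
Qed.

End Mirror.

Definition left_determined (A : choiceType) (X : set (fullshift A))
    (psi : fullshift A -> fullshift A) (Q : int) :=
  forall a b, X a -> X b -> (forall j : int, 0 <= j -> a j = b j) ->
    (forall j : int, Q - 1 <= j -> psi a j = psi b j) -> a (-1) = b (-1).

Lemma mirror_right_determined (A : choiceType) (X : set (fullshift A))
    (psi : fullshift A -> fullshift A) Q :
  right_determined (mirror_set X) (mirror_map psi) Q <-> left_determined X psi Q.
Proof.
split=> D a b Xa Xb ab pab.
  apply: (D (mirror a) (mirror b)); rewrite /mirror_set /= ?mirrorK //.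
    by move=> j j0; apply: ab; lia.
  by rewrite /mirror_map /= !mirrorK => j jQ; apply: pab; lia.
have := D _ _ Xa Xb; rewrite /mirror opprK; apply=> j jQ.
  by apply: ab; lia.
have := pab (- j); rewrite /mirror_map /= /mirror opprK; apply; lia.
Qed.

Definition rev_graph (G : graph) : graph :=
  @Graph (g_arc G) (g_vertex G) (@g_term G) (@g_init G).

Definition rev_hom (Gam G : graph) (h : graph_hom Gam G) :
    graph_hom (rev_graph Gam) (rev_graph G) :=
  @GraphHom (rev_graph Gam) (rev_graph G) (hom_arc h) (hom_vertex h)
    (hom_term h) (hom_init h).

Definition rev_textile (T : textile) : textile :=
  Textile (rev_hom (tx_p T)) (rev_hom (tx_q T)).

Lemma rev_textile_presented_by (A : finType) (X : set (fullshift A))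
    (psi : fullshift A -> fullshift A) (T : textile) :
  presented_by X psi T -> presented_by (mirror_set X) (mirror_map psi) (rev_textile T).
Proof.
have block_mirror (B C : choiceType) (h : B -> C) x :
  block_map h (mirror x) = mirror (block_map h x) by [].
have image_mirror (B C : choiceType) (h : B -> C) Y :
    block_map h @` (mirror_set Y) = mirror_set (block_map h @` Y).
  apply/seteqP; split=> [_ [x Yx <-]|x [y Yy yx]].
    by exists (mirror x).
  by exists (mirror y); rewrite /mirror_set /= ?mirrorK // block_mirror yx mirrorK.
case: T => Gam G p q [/= iota [Z [inj_iota [/subshiftP[cZ sZ] Zpath]]]].
move=> [inj_p pZ] qZ psiE.
exists iota, (mirror_set Z); split=> /=.
- by move=> x y i j Xx Xy; have := inj_iota _ _ (- i) (- j) Xx Xy; rewrite /mirror !opprK.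
- split.
    apply/subshiftP; split; first exact: mirror_cyl_closed.
    exact: mirror_shift_invariant.
  move=> z Zz j; have := Zpath _ Zz (- (j + 1)).
  rewrite /mirror opprK (_ : - (- (j + 1) + 1) = j) /=; last by lia.
  exact: esym.
- split.
    move=> z w /set_mem Zz /set_mem Zw zw; apply: (can_inj (@mirrorK _)).
    by apply: inj_p; rewrite ?inE //; exact: (congr1 (@mirror _) zw).
  by rewrite [LHS]image_mirror [in LHS]pZ image_mirror.
- by rewrite /phi_hom !image_mirror => z /qZ.
- move=> z x Zz Xx zx; rewrite -[z]mirrorK.
  have E : block_map iota (psi (mirror x)) = phi_hom q (mirror z).
    by apply: psiE => //; exact: (congr1 (@mirror _) zx).
  exact: (congr1 (@mirror _) E).
Qed.

Lemma weakly_qL_mirror (A : finType) (X : set (fullshift A))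
    (psi : fullshift A -> fullshift A) :
  weakly_qL X psi <-> weakly_qR (mirror_set X) (mirror_map psi).
Proof.
split=> -[T Tq TX]; exists (rev_textile T).
- by move=> a b; exact: Tq.
- exact: rev_textile_presented_by.
- by move=> a b; exact: Tq.
- by have := rev_textile_presented_by TX; rewrite mirror_preimageK mirror_mapK.
Qed.

Lemma weakly_qLP (A : finType) (X : set (fullshift A))
    (psi : fullshift A -> fullshift A) :
  cyl_closed X -> shift_invariant X -> sliding_block X psi ->
  weakly_qL X psi <-> left_determined X psi 0.
Proof.
move=> cX sX psiX; rewrite weakly_qL_mirror -mirror_right_determined.
apply: weakly_qRP; first exact: mirror_cyl_closed.
  exact: mirror_shift_invariant.
exact: mirror_sliding_block.
Qed.

(** * Left q-degrees *)

(** As on the right: the images of two points with the same future agree from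
coordinate [m] on. *)
Lemma left_mergibleP (A : finType) (X : set (fullshift A))
    (phi : fullshift A -> fullshift A) (m n : nat) (f : (m + n).+1.-tuple A -> A) l :
  of_type X phi f ->
  left_mergible X f l <-> left_determined X phi (m%:Z - l%:Z).
Proof.
move=> [_ phiE].
have fE a (j : int) : X a -> f (word (m + n) a j) = phi a (j + m%:Z).
  by move=> Xa; rewrite phiE //; congr (f (word _ _ _)); lia.
split=> H a b Xa Xb ab pab; apply: H => // j jk.
  by rewrite !fE // pab //; lia.
have [j0|j1] := lerP m%:Z j.
  rewrite !phiE //; congr f; apply: eq_from_tnth => i; rewrite !tnth_mktuple.
  by apply: ab; lia.
by have := pab (m%:Z - j); rewrite !fE // opprB subrK; apply; lia.
Qed.

Lemma infinite_left_determined_le (A : finType) (X : set (fullshift A))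
    (phi : fullshift A -> fullshift A) (m n : nat) (f : (m + n).+1.-tuple A -> A) Q :
  cyl_closed X -> shift_invariant X -> ~ finite_set X -> of_type X phi f ->
  left_determined X phi Q -> Q <= m%:Z.
Proof.
move=> cX sX nfX [_ phiE] D; rewrite leNgt; apply/negP => mQ; apply: nfX.
apply/mirror_finite/past_determined_finite.
- exact: mirror_cyl_closed.
- exact: mirror_shift_invariant.
move=> a b Xa Xb ab.
have {}ab (j : int) : 0 <= j -> mirror a j = mirror b j by move=> j0; apply: ab; lia.
apply: (D (mirror a) (mirror b)) => // j jQ.
rewrite !phiE //; congr f; apply: eq_from_tnth => i; rewrite !tnth_mktuple.
by apply: ab; lia.
Qed.

Lemma Q_L_left_determined (A : finType) (X : set (fullshift A))
    (phi : fullshift A -> fullshift A) Q :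
  (0 < #|A|)%N -> cyl_closed X -> shift_invariant X -> sliding_block X phi ->
  left_determined X phi Q <-> (Q%:E <= Q_L X phi)%E.
Proof.
move=> A0 cX sX phiX; rewrite /Q_L; case: asboolP => [fX|nfX].
  rewrite leey; split=> // _; apply/mirror_right_determined.
  apply: finite_right_determined; first exact: mirror_shift_invariant.
  exact/mirror_finite.
set S := [set q | _]; have : S !=set0.
  have [m [n [f phif]]] := of_type_exists A0 sX phiX.
  have [k fk] := least_or_infty_exists (left_mergible X f).
  by exists ((m%:Z)%:E - k)%E, m, n, f, k; split.
move=> /(xgetPex +oo%E)[m [n [f [k [phif fk ->]]]]].
apply: least_or_infty_degree fk Q.
- move=> Q Q' QQ /mirror_right_determined D.
  exact/mirror_right_determined/(right_determinedW QQ).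
- by move=> Q0; exact: (infinite_left_determined_le cX sX nfX phif).
- by move=> i; exact: (left_mergibleP i phif).
Qed.

Lemma left_determined_shift (A : choiceType) (X : set (fullshift A))
    (psi : fullshift A -> fullshift A) Q s :
  (forall s x, X x -> psi (shiftz s x) = shiftz s (psi x)) ->
  left_determined X (psi \o shiftz s) Q <-> left_determined X psi (Q + s).
Proof.
move=> psis; split=> D a b Xa Xb ab pab; apply: D => // j jQ.
  by rewrite /= !psis // /shiftz pab //; lia.
have := pab (j - s); rewrite /= !psis // /shiftz subrK; apply; lia.
Qed.

Lemma left_determined_orbit (A : choiceType) (X : set (fullshift A))
    (psi : fullshift A -> fullshift A) a b :
  shift_invariant X -> sliding_block X psi -> left_determined X psi 1 ->
  X a -> X b ->
  (forall i (j : int), 0 <= j -> iter i psi a j = iter i psi b j) -> a = b.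
Proof.
move=> sX psiX /mirror_right_determined D Xa Xb ab; apply: (can_inj (@mirrorK A)).
have iterE i x : iter i (mirror_map psi) (mirror x) = mirror (iter i psi x).
  by elim: i => //= i ->; rewrite /mirror_map /= mirrorK.
have [psiX' _ psis] := mirror_sliding_block psiX.
apply: (right_determined_orbit (mirror_shift_invariant sX) psis D psiX').
- by rewrite /mirror_set /= mirrorK.
- by rewrite /mirror_set /= mirrorK.
by move=> i j j0; rewrite !iterE; apply: ab; lia.
Qed.

(** * Expansiveness *)

(** For a fixed point [u] this is the compatibility of [d]; it holds uniformly
because pairs of points at distances tending to 0 with distinct letters at 0
would accumulate at some [u], around which all letters at 0 are equal. *)
Lemma compatible_metric_separates (A : finType) (X : set (fullshift A))
    (R : realType) (d : fullshift A -> fullshift A -> R) :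
  cyl_closed X -> compatible_metric X d ->
  exists2 delta, 0 < delta & forall x y, X x -> X y -> d x y <= delta -> x 0 = y 0.
Proof.
move=> cX [_ _ _ dD dX]; apply: contrapT => /forall2NP H.
have {}H n : exists xy : fullshift A * fullshift A,
    [/\ X xy.1, X xy.2, d xy.1 xy.2 <= n.+1%:R^-1 & xy.1 0 <> xy.2 0].
  have [|/existsNP[x /existsNP[y]]] := H (n.+1%:R^-1 : R).
    by rewrite invr_gt0 ltr0n.
  by move=> /not_implyP[Xx] /not_implyP[Xy] /not_implyP[xy nxy]; exists (x, y).
have [xy xyP] := choice H; have [u uP] := subsequential_limit (fun n => (xy n).1).
have Xu : X u.
  by apply: cX => L; have [n _ un] := uP L 0%N; exists (xy n).1 => //; case: (xyP n).
have [|e e0 ue] := (dX u Xu [set y | u 0 = y 0]).1.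
  by apply: filterS (nbhs_agree u 0) => y uy _; exact: uy.
have /nbhs_agreeP[L uL] : within X (nbhs u) [set y | d u y < e / 2].
  by apply/(dX u Xu); exists (e / 2) => //; rewrite divr_gt0.
have [N eN] : exists N : nat, N.+1%:R^-1 < e / 2.
  have e2 : 0 < e / 2 by rewrite divr_gt0.
  exists (Num.truncn (e / 2)^-1).
  rewrite invf_plt ?posrE ?ltr0n //.
  exact: truncnS_gt.
have [n Nn un] := uP L N; case: (xyP n) => Xx Xy dxy; apply.
have dux := uL _ un Xx.
have dxy' : d (xy n).1 (xy n).2 < e / 2.
  apply: le_lt_trans eN; apply: le_trans dxy _.
  by rewrite lef_pV2 ?posrE ?ltr0n // ler_nat.
rewrite -(ue _ Xy) ?(ue _ Xx) //.
- by apply: lt_le_trans dux _; rewrite ler_pdivrMr // ler_peMr ?ler1n ?ltW.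
- apply: le_lt_trans (dD _ _ _ Xu Xx Xy) _; rewrite [ltRHS](splitr e).
  exact: ltrD.
Qed.

Lemma lte_succ_le (t : int) (q : \bar int) : (t%:E < q -> (t + 1)%:E <= q)%E.
Proof. by case: q => [q||] //=; rewrite ?leey // lte_fin lee_fin; lia. Qed.

Lemma right_determined_left_expansive (A : finType) (X : set (fullshift A))
    (R : realType) (d : fullshift A -> fullshift A -> R)
    (psi : fullshift A -> fullshift A) :
  cyl_closed X -> shift_invariant X -> sliding_block X psi ->
  compatible_metric X d -> right_determined X psi 1 ->
  positively_left_expansive X d psi.
Proof.
move=> cX sX [psiX _ psis] /(compatible_metric_separates cX)[delta delta0 dX] D.
exists delta => // x y Xx Xy xy.
have Xi i z : X z -> X (iter i psi z) by move=> Xz; elim: i => //= i; exact: psiX.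
apply: (right_determined_orbit sX psis D psiX) => // i j j0.
have := dX _ _ (sX j _ (Xi i x Xx)) (sX j _ (Xi i y Xy)) (xy i j j0).
by rewrite /shiftz add0r.
Qed.

Lemma left_determined_right_expansive (A : finType) (X : set (fullshift A))
    (R : realType) (d : fullshift A -> fullshift A -> R)
    (psi : fullshift A -> fullshift A) :
  cyl_closed X -> shift_invariant X -> sliding_block X psi ->
  compatible_metric X d -> left_determined X psi 1 ->
  positively_right_expansive X d psi.
Proof.
move=> cX sX psiX /(compatible_metric_separates cX)[delta delta0 dX] D.
exists delta => // x y Xx Xy xy.
have Xi i z : X z -> X (iter i psi z).
  by case: psiX => psiX _ _ Xz; elim: i => //= i; exact: psiX.
apply: (left_determined_orbit sX psiX D) => // i j j0.
have := dX _ _ (sX j _ (Xi i x Xx)) (sX j _ (Xi i y Xy)) (xy i j j0).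
by rewrite /shiftz add0r.
Qed.

Theorem theorem5p2 (A : finType) (hA : (2 <= #|A|)%N)
    (X : set (fullshift A)) (hX : subshift X)
    (phi : fullshift A -> fullshift A) (hphi : endomorphism X phi)
    (R : realType) (d : fullshift A -> fullshift A -> R)
    (hd : compatible_metric X d) (s : int) :
  [/\ weakly_qR X phi <-> (0 <= Q_R X phi)%E,
      weakly_qR X (phi \o shiftz s) <-> (- Q_R X phi <= s%:E)%E &
      (- Q_R X phi < s%:E)%E ->
        positively_left_expansive X d (phi \o shiftz s)] /\
  [/\ weakly_qL X phi <-> (0 <= Q_L X phi)%E,
      weakly_qL X (phi \o shiftz s) <-> (s%:E <= Q_L X phi)%E &
      (s%:E < Q_L X phi)%E ->
        positively_right_expansive X d (phi \o shiftz s)].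
Proof.
have A0 : (0 < #|A|)%N by exact: ltnW.
have [cX sX] := (subshiftP X).1 hX.
have phiX := endomorphism_sliding_block cX sX hphi.
have psiX := sliding_block_shift s sX phiX.
have phis : forall t x, X x -> phi (shiftz t x) = shiftz t (phi x) by case: phiX.
have QR Q := Q_R_right_determined Q A0 cX sX phiX.
have QL Q := Q_L_left_determined Q A0 cX sX phiX.
split; split.
- by rewrite (weakly_qRP cX sX phiX); exact: QR.
- rewrite (weakly_qRP cX sX psiX) (right_determined_shift phis) sub0r.
  by rewrite leeNl; exact: QR.
- rewrite lteNl => /lte_succ_le sQ; apply: right_determined_left_expansive => //.
  apply/(right_determined_shift phis)/QR.
  by rewrite addrC.
- by rewrite (weakly_qLP cX sX phiX); exact: QL.
- rewrite (weakly_qLP cX sX psiX) (left_determined_shift _ _ phis) add0r.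
  exact: QL.
- move=> /lte_succ_le sQ; apply: left_determined_right_expansive => //.
  apply/(left_determined_shift _ _ phis)/QL.
  by rewrite addrC.
Qed.
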